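(* Let $S$ be a semigroup, let $P_1^{\Box}$ and $P_2^{\Box}$ be any two cubic Pythagorean fuzzy sets on $S$, and let $\omega$ be a complete congruence relation on $S$. Then $$\underline{App}(P_1^{\Box})\circ\underline{App}(P_2^{\Box})\subseteq\underline{App}(P_1^{\Box}\circ P_2^{\Box}).$$
   Context: Congruence: an equivalence relation $\omega$ on $S$ is a congruence relation if $(z_1,z_2)\in\omega$ implies $(z_1x,z_2x)\in\omega$ and $(xz_1,xz_2)\in\omega$ for all $x\in S$. $[z]_\omega$ denotes the class of $z$; one always has $[z_1]_\omega[z_2]_\omega\subseteq[z_1z_2]_\omega$, and $\omega$ is complete if $[z_1]_\omega[z_2]_\omega=[z_1z_2]_\omega$ for all $z_1,z_2\in S$. Intervals: closed subintervals $[a^-,a^+]$ of $[0,1]$ are ordered componentwise; infima $\bigwedge$ and suprema $\bigvee$ are taken componentwise. The supremum over an empty family is $0$ (resp. $[0,0]$), and the infimum over an empty family is $1$ (resp. $[1,1]$). A cubic Pythagorean fuzzy set (CPFS) on $S$ is $P^{\Box}=(\zeta_{p^\Box},\eta_{p^\Box})=\{\langle z,[\zeta_{\widetilde p}(z),\eta_{\widetilde p}(z)],(\zeta_p(z),\eta_p(z))\rangle : z\in S\}$, where $\zeta_{\widetilde p}(z)=[\zeta_p^-(z),\zeta_p^+(z)]$ and $\eta_{\widetilde p}(z)=[\eta_p^-(z),\eta_p^+(z)]$ are closed subintervals of $[0,1]$ with $(\zeta_p^+(z))^2+(\eta_p^+(z))^2\le 1$, and $\zeta_p(z),\eta_p(z)\in[0,1]$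 with $\zeta_p(z)^2+\eta_p(z)^2\le 1$. Here $\zeta_p,\eta_p$ are independent data. Write $\zeta_{p^\Box}=(\zeta_{\widetilde p},\zeta_p)$ and $\eta_{p^\Box}=(\eta_{\widetilde p},\eta_p)$; order, $\bigwedge$ and $\bigvee$ on such pairs are componentwise. Composition: $P_1^\Box\circ P_2^\Box=(\zeta_{p_1^\Box}\circ\zeta_{p_2^\Box},\ \eta_{p_1^\Box}\circ\eta_{p_2^\Box})$ with $(\zeta_{p_1^\Box}\circ\zeta_{p_2^\Box})(z)=\bigvee_{z=z_1z_2}[\zeta_{p_1^\Box}(z_1)\wedge\zeta_{p_2^\Box}(z_2)]$ and $(\eta_{p_1^\Box}\circ\eta_{p_2^\Box})(z)=\bigwedge_{z=z_1z_2}[\eta_{p_1^\Box}(z_1)\vee\eta_{p_2^\Box}(z_2)]$. The formulas are applied as they stand to any pair $(\zeta,\eta)$ of such functions. Inclusion: $(\zeta,\eta)\subseteq(\zeta',\eta')$ means $\zeta(z)\le\zeta'(z)$ and $\eta(z)\ge\eta'(z)$ for all $z\in S$, in both the interval and the number component. Lower approximation: $\underline{App}(P^\Box)=(\underline{\zeta_{p^\Box}},\underline{\eta_{p^\Box}})$ with $\underline{\zeta_{p^\Box}}(z)=\bigwedge_{z'\in[z]_\omega}\zeta_{p^\Box}(z')$ and $\underline{\eta_{p^\Box}}(z)=\bigvee_{z'\in[z]_\omega}\eta_{p^\Box}(z')$, componentwise for the interval and number parts. *)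

(* Defs.v *)
From mathcomp Require Import all_boot all_order all_algebra.
From mathcomp Require Import all_classical all_reals.
From mathcomp Require Import interval_inference.
From Stdlib Require Import Relation_Definitions.
Set Implicit Arguments.
Unset Strict Implicit.
Unset Printing Implicit Defensive.
Import Order.TTheory GRing.Theory Num.Theory.
Local Open Scope classical_set_scope.
Local Open Scope ring_scope.

Section Congruence.
Variable S : semigroupType.
Implicit Type omega : S -> S -> Prop.

Definition congruence omega : Prop :=
  equivalence S omega /\
  forall z1 z2, omega z1 z2 ->
    forall x, omega (z1 * x)%g (z2 * x)%g /\ omega (x * z1)%g (x * z2)%g.

Definition eqclass omega (z : S) : set S := [set z' | omega z z'].

Definition complete_congruence omega : Prop :=
  congruence omega /\
  forall z1 z2,
    [set (x * y)%g | x in eqclass omega z1 & y in eqclass omega z2]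
    = eqclass omega (z1 * z2)%g.

End Congruence.

Section UnitInterval.
Variable R : realType.
Implicit Type A : set {i01 R}.

(* The library's [sup] and [inf] on [R] are both [0] on [set0]: this is the
   supremum of the empty family in [0, 1], but its infimum there is [1]. *)
Definition sup01_val A : R := sup [set x%:num | x in A].
Definition inf01_val A : R :=
  if `[< A !=set0 >] then inf [set x%:num | x in A] else 1.

Lemma ubound01 A : ubound [set x%:num | x in A] 1.
Proof. by move=> _ [x _ <-]. Qed.

Lemma lbound01 A : lbound [set x%:num | x in A] 0.
Proof. by move=> _ [x _ <-]. Qed.

Lemma sup01_ub A (x : {i01 R}) : A x -> x%:num <= sup01_val A.
Proof.
move=> Ax; apply: ub_le_sup; last by exists x.
by exists 1; exact: ubound01.
Qed.

Lemma sup01_lub A (b : R) : 0 <= b ->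
  (forall x, A x -> x%:num <= b) -> sup01_val A <= b.
Proof.
move=> b0 bA; rewrite /sup01_val.
have [->|/set0P [x Ax]] := eqVneq A set0; first by rewrite image_set0 sup0.
apply: ge_sup; first by exists x%:num, x.
by move=> _ [y Ay <-]; exact: bA.
Qed.

Lemma inf01_lb A (x : {i01 R}) : A x -> inf01_val A <= x%:num.
Proof.
move=> Ax; rewrite /inf01_val; case: asboolP => [_|[]]; last by exists x.
by apply: ge_inf; [exists 0; exact: lbound01|exists x].
Qed.

Lemma inf01_glb A (b : R) : b <= 1 ->
  (forall x, A x -> b <= x%:num) -> b <= inf01_val A.
Proof.
move=> b1 bA; rewrite /inf01_val; case: asboolP => // -[x Ax].
apply: lb_le_inf; first by exists x%:num, x.
by move=> _ [y Ay <-]; exact: bA.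
Qed.

Lemma sup01_ge0 A : 0 <= sup01_val A.
Proof.
have [->|/set0P [x Ax]] := eqVneq A set0.
  by rewrite /sup01_val image_set0 sup0.
exact: le_trans (sup01_ub Ax).
Qed.

Lemma sup01_le1 A : sup01_val A <= 1.
Proof. by apply: sup01_lub => // x _. Qed.

Lemma inf01_ge0 A : 0 <= inf01_val A.
Proof. by apply: inf01_glb => // x _. Qed.

Lemma inf01_le1 A : inf01_val A <= 1.
Proof.
have [->|/set0P [x Ax]] := eqVneq A set0.
  by rewrite /inf01_val; case: asboolP => // -[].
exact: le_trans (inf01_lb Ax) _.
Qed.

Definition sup01 A : {i01 R} := Itv01 (sup01_ge0 A) (sup01_le1 A).
Definition inf01 A : {i01 R} := Itv01 (inf01_ge0 A) (inf01_le1 A).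

End UnitInterval.

Section ClosedIntervals.
Variable R : realType.

Record cint : Type := Cint {
  lo : {i01 R};
  hi : {i01 R};
  lo_le_hi : lo <= hi }.

Implicit Types (I J : cint) (A : set cint).

Lemma cmin_subproof I J : Order.min (lo I) (lo J) <= Order.min (hi I) (hi J).
Proof. by rewrite le_min !ge_min !lo_le_hi orbT. Qed.

Lemma cmax_subproof I J : Order.max (lo I) (lo J) <= Order.max (hi I) (hi J).
Proof. by rewrite ge_max !le_max !lo_le_hi orbT. Qed.

Lemma csup_subproof A : sup01 (lo @` A) <= sup01 (hi @` A).
Proof.
apply: sup01_lub; first exact: sup01_ge0.
move=> _ [I AI <-]; apply: (@le_trans _ _ (hi I)%:num); first exact: lo_le_hi.
by apply: sup01_ub; exists I.
Qed.

Lemma cinf_subproof A : inf01 (lo @` A) <= inf01 (hi @` A).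
Proof.
apply: inf01_glb; first exact: inf01_le1.
move=> _ [I AI <-]; apply: (@le_trans _ _ (lo I)%:num); last exact: lo_le_hi.
by apply: inf01_lb; exists I.
Qed.

Definition cle I J : Prop := lo I <= lo J /\ hi I <= hi J.
Definition cmin I J : cint := Cint (cmin_subproof I J).
Definition cmax I J : cint := Cint (cmax_subproof I J).
Definition csup A : cint := Cint (csup_subproof A).
Definition cinf A : cint := Cint (cinf_subproof A).

End ClosedIntervals.

Section CubicGrades.
Variable R : realType.

Record grade : Type := Grade { itvpart : cint R; numpart : {i01 R} }.

Implicit Types (a b : grade) (A : set grade).

Definition gle a b : Prop :=
  cle (itvpart a) (itvpart b) /\ numpart a <= numpart b.
Definition gmin a b : grade :=
  Grade (cmin (itvpart a) (itvpart b)) (Order.min (numpart a) (numpart b)).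
Definition gmax a b : grade :=
  Grade (cmax (itvpart a) (itvpart b)) (Order.max (numpart a) (numpart b)).
Definition gsup A : grade :=
  Grade (csup (itvpart @` A)) (sup01 (numpart @` A)).
Definition ginf A : grade :=
  Grade (cinf (itvpart @` A)) (inf01 (numpart @` A)).

End CubicGrades.

(* Pairs of grade functions without the Pythagorean constraint: composition and
   lower approximation are defined on these, so that they can be iterated. *)
Record gpair (R : realType) (S : Type) : Type := Gpair {
  zeta : S -> grade R;
  eta : S -> grade R }.

Record cpfs (R : realType) (S : Type) : Type := Cpfs {
  cpfs_pair :> gpair R S;
  cpfs_itv : forall z,
    (hi (itvpart (zeta cpfs_pair z)))%:num ^+ 2
    + (hi (itvpart (eta cpfs_pair z)))%:num ^+ 2 <= 1;
  cpfs_num : forall z,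
    (numpart (zeta cpfs_pair z))%:num ^+ 2
    + (numpart (eta cpfs_pair z))%:num ^+ 2 <= 1 }.

Section Operations.
Variables (R : realType) (S : semigroupType).
Implicit Types (P Q : gpair R S) (omega : S -> S -> Prop).

Definition factorizations (z : S) : set (S * S) :=
  [set p | z = (p.1 * p.2)%g].

Definition gcomp P Q : gpair R S := Gpair
  (fun z => gsup [set gmin (zeta P p.1) (zeta Q p.2) | p in factorizations z])
  (fun z => ginf [set gmax (eta P p.1) (eta Q p.2) | p in factorizations z]).

Definition gincl P Q : Prop :=
  forall z, gle (zeta P z) (zeta Q z) /\ gle (eta Q z) (eta P z).

Definition lower_app omega P : gpair R S := Gpair
  (fun z => ginf [set zeta P z' | z' in eqclass omega z])
  (fun z => gsup [set eta P z' | z' in eqclass omega z]).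

End Operations.

(* Main.v *)
Require Import Defs.
From mathcomp Require Import all_boot all_order all_algebra.
From mathcomp Require Import all_classical all_reals.
From mathcomp Require Import interval_inference.
Import Order.TTheory.
Local Open Scope ring_scope.

(** Grades form a complete lattice.  If [z = x * y] and [z'] is equivalent to
    [z], completeness of the congruence gives [z' = x' * y'] with [x'] and [y']
    equivalent to [x] and [y]: every factorization of [z] contributing to the
    left-hand side is thus dominated by a factorization of each [z']. *)

Section GradeOrder.
Variable R : realType.
Implicit Types (a b c d : grade R) (A : set (grade R)).

(** Empty [B] is covered as well: since [x] lies in the unit interval, the side condition
    [0 <= x%:num] of [sup01_lub] is automatic. *)
Lemma sup01_le (B : set {i01 R}) (x : {i01 R}) :
  (forall y, B y -> y <= x) -> sup01 B <= x.
Proof. exact: (@sup01_lub _ B x%:num). Qed.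

Lemma le_inf01 (B : set {i01 R}) (x : {i01 R}) :
  (forall y, B y -> x <= y) -> x <= inf01 B.
Proof. exact: (@inf01_glb _ B x%:num). Qed.

Lemma gle_trans b a c : gle a b -> gle b c -> gle a c.
Proof.
move=> [[la ha] na] [[lb hb] nb].
by split; [split|]; [exact: le_trans lb|exact: le_trans hb|exact: le_trans nb].
Qed.

(** Order and [gsup] are coordinatewise, which leaves three suprema in the unit interval: lower end,
    upper end, number. *)
Lemma gle_gsup A a : A a -> gle a (gsup A).
Proof.
move=> Aa; split; [split|]; apply: sup01_ub.
- by exists (itvpart a) => //; exists a.
- by exists (itvpart a) => //; exists a.
- by exists a.
Qed.

Lemma gsup_gle A b : (forall a, A a -> gle a b) -> gle (gsup A) b.
Proof.
move=> Ab; split; [split|]; apply: sup01_le.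
- by move=> _ [_ [a Aa <-] <-]; case: (Ab a Aa) => -[].
- by move=> _ [_ [a Aa <-] <-]; case: (Ab a Aa) => -[].
- by move=> _ [a Aa <-]; case: (Ab a Aa).
Qed.

Lemma ginf_gle A a : A a -> gle (ginf A) a.
Proof.
move=> Aa; split; [split|]; apply: inf01_lb.
- by exists (itvpart a) => //; exists a.
- by exists (itvpart a) => //; exists a.
- by exists a.
Qed.

Lemma gle_ginf A b : (forall a, A a -> gle b a) -> gle b (ginf A).
Proof.
move=> bA; split; [split|]; apply: le_inf01.
- by move=> _ [_ [a Aa <-] <-]; case: (bA a Aa) => -[].
- by move=> _ [_ [a Aa <-] <-]; case: (bA a Aa) => -[].
- by move=> _ [a Aa <-]; case: (bA a Aa).
Qed.

Lemma gmin_mono a b c d : gle a c -> gle b d -> gle (gmin a b) (gmin c d).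
Proof. by move=> [[? ?] ?] [[? ?] ?]; split; [split|]; exact: le_min2. Qed.

Lemma gmax_mono a b c d : gle a c -> gle b d -> gle (gmax a b) (gmax c d).
Proof. by move=> [[? ?] ?] [[? ?] ?]; split; [split|]; exact: le_max2. Qed.

End GradeOrder.

(** Elementwise form of the inclusion of [[xy]] in [[x][y]], which is what completeness adds to a
    congruence. *)
Lemma complete_congruence_factor {S : semigroupType} {omega : S -> S -> Prop}
    {x y z : S} : complete_congruence omega -> omega (x * y)%g z ->
  exists x' y', [/\ omega x x', omega y y' & z = (x' * y')%g].
Proof.
move=> [_ /(_ x y) xyE] xyz.
have : eqclass omega (x * y)%g z by [].
by rewrite -xyE => -[x' xx' [y' yy' <-]]; exists x', y'.
Qed.

Theorem theorem3p1 (R : realType) (S : semigroupType) (P1 P2 : cpfs R S)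
    (omega : S -> S -> Prop) (homega : complete_congruence omega) :
  gincl (gcomp (lower_app omega P1) (lower_app omega P2))
        (lower_app omega (gcomp P1 P2)).
Proof.
move=> z; split.
(* If [z] has no factorization, the left side is the bottom grade and nothing remains to check. *)
- apply: gsup_gle => _ [[x y] /= -> <-].
  apply: gle_ginf => _ [z' zz' <-].
  have [x' [y' [xx' yy' ->]]] := complete_congruence_factor homega zz'.
  (* Each class infimum is below its value at [x'] or [y'], and this minimum is one term of the
     supremum at [x' * y']. *)
  apply: (@gle_trans _ (gmin (zeta P1 x') (zeta P2 y'))).
    by apply: gmin_mono; apply: ginf_gle; [exists x'|exists y'].
  by apply: gle_gsup; exists (x', y').
(* Inclusion reverses the order on [eta], so the dual argument applies, with suprema over classes
   and infima over factorizations. *)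
- apply: gle_ginf => _ [[x y] /= -> <-].
  apply: gsup_gle => _ [z' zz' <-].
  have [x' [y' [xx' yy' ->]]] := complete_congruence_factor homega zz'.
  apply: (@gle_trans _ (gmax (eta P1 x') (eta P2 y'))).
    by apply: ginf_gle; exists (x', y').
  by apply: gmax_mono; apply: gle_gsup; [exists x'|exists y'].
Qed.
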